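(* Let $d$ be fixed and $0<c<1$. With probability tending to $1$ as $n\to\infty$, a uniformly random element of $\mathcal{G}_{d,c}(n)$ has fewer than $\frac{\log\log n}{\log n}\, n$ bad nodes. Consequently, the number of triangles of such a graph that are not part of a $(d+1)$-clique is $o(n)$.
   Context: $T_{\max}=\binom{d}{2}\frac{n}{3}$. $\mathcal{G}_{d,c}(n)$ is the set of $d$-regular graphs on $n$ labeled nodes containing at least $c\cdot T_{\max}$ triangles. A node of a graph is called bad if it is incident to at least one triangle but is not contained in any clique on $d+1$ nodes. *)

(* Defs.v *)
From HB Require Import structures.
From mathcomp Require Import all_boot all_order all_algebra.
From mathcomp Require Import reals exp.
Set Implicit Arguments. Unset Strict Implicit. Unset Printing Implicit Defensive.
Import Order.TTheory GRing.Theory Num.Theory.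

Definition graph (n : nat) := {ffun 'I_n * 'I_n -> bool}.

Definition adj n (g : graph n) (x y : 'I_n) : bool := g (x, y).

Definition simple n (g : graph n) : bool :=
  [forall x, forall y, adj g x y == adj g y x] && [forall x, ~~ adj g x x].

Definition regular n (d : nat) (g : graph n) : bool :=
  [forall v, #|[set u | adj g v u]| == d].

Definition is_clique n (g : graph n) (S : {set 'I_n}) : bool :=
  [forall x in S, forall y in S, (x != y) ==> adj g x y].

Definition triangles n (g : graph n) : {set {set 'I_n}} :=
  [set t : {set 'I_n} | (#|t| == 3) && is_clique g t].

Definition cliques n (g : graph n) (k : nat) : {set {set 'I_n}} :=
  [set S : {set 'I_n} | (#|S| == k) && is_clique g S].

Definition bad_nodes n (d : nat) (g : graph n) : {set 'I_n} :=
  [set v | [exists t in triangles g, v \in t]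
           && ~~ [exists S in cliques g d.+1, v \in S]].

Definition nonclique_triangles n (d : nat) (g : graph n) : {set {set 'I_n}} :=
  [set t in triangles g | ~~ [exists S in cliques g d.+1, t \subset S]].

Local Open Scope ring_scope.

Definition Tmax (R : realType) (d n : nat) : R := ('C(d, 2))%:R * n%:R / 3.

Definition Gdc (R : realType) (d : nat) (c : R) (n : nat) : {set graph n} :=
  [set g : graph n | [&& simple g, regular d g &
                        c * Tmax R d n <= (#|triangles g|)%:R]].

Definition probG (R : realType) (d : nat) (c : R) (n : nat)
  (P : graph n -> bool) : R :=
  (#|[set g in Gdc d c n | P g]|)%:R / (#|Gdc d c n|)%:R.

(* Main.v *)
Require Import Defs.
From HB Require Import structures.
From mathcomp Require Import all_boot all_order all_algebra.
From mathcomp Require Import fingroup perm.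
From mathcomp Require Import boolp reals sequences exp.
From mathcomp Require Import zify ring lra.
Import Order.TTheory GRing.Theory Num.Theory.

(** Fix an order of the nodes and reveal the graph node by node.  An edge [uv]
    is free to describe, up to a bounded number of choices, when [u] and [v] have
    a common neighbour preceding both of them, and costs [ln n] otherwise.  In a
    uniformly random order an edge lying in [k] triangles is paid with probability
    [2/(k+2)], and [2/(k+2) <= 1 - k/(d+1)] with equality only for [k = 0] and
    [k = d-1].  So the expected number of paid edges of a graph with [t] triangles
    is at most [dn/2 - 3t/(d+1)], with an extra constant saving at every bad node,
    because a bad node lies on an edge with [0 < k < d-1].  Averaged over the
    order by Jensen's inequality, this bounds the number of graphs with [b] bad
    nodes by [exp((dn/2 - 3cT/(d+1) - C b) ln n + O(n))], where [T] is [Tmax].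
    Lifts of [K_(d+1)] with about [cn/(d+1)] planted cliques show that the whole
    class has at least [exp((dn/2 - 3cT/(d+1)) ln n - O(n))] elements, and for
    [b = n ln ln n / ln n] the saving [C b ln n] beats the error terms. *)

Set Implicit Arguments.
Unset Strict Implicit.
Unset Printing Implicit Defensive.
Local Open Scope nat_scope.

(** * Encoding along a node order *)

Section Encoding.

Variable n d : nat.
Implicit Types (g : graph n) (p : {perm 'I_n}) (u v w : 'I_n).

Definition regular_graph g := simple g && regular d g.

Lemma adjC g u v : regular_graph g -> adj g u v = adj g v u.
Proof. by case/andP=> /andP[/forallP/(_ u)/forallP/(_ v)/eqP]. Qed.

Lemma adjxx g u : regular_graph g -> adj g u u = false.
Proof. by case/andP=> /andP[_ /forallP/(_ u)/negbTE]. Qed.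

Lemma adj_neq g u v : regular_graph g -> adj g u v -> u != v.
Proof. by move=> Hg; apply: contraTneq => ->; rewrite adjxx. Qed.

Lemma card_adj g u : regular_graph g -> #|[set v | adj g u v]| = d.
Proof. by case/andP=> _ /forallP/(_ u)/eqP. Qed.

Definition common g u v := [set w | adj g u w && adj g v w].

(** An edge is paid exactly when one of its ends comes first in this set. With [k] common neighbours
    the set has [k + 2] nodes, whence the probability [2/(k+2)]. *)
Definition edge_nbhd g u v := u |: (v |: common g u v).

(* The edge [uv] is paid for, and [u] is its earlier end. *)
Definition root p g u v := adj g u v && [forall y in edge_nbhd g u v, p u <= p y].

Definition roots p g := \sum_v \sum_u root p g u v.

(** Sorted by [p], so that a witness, which precedes the neighbour it serves, occupies an earlier
    slot. *)
Definition back p g v :=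
  sort (fun x y => p x <= p y) (enum [set u | adj g v u && (p u < p v)]).

Definition early p g v w := enum [set x | adj g w x && (p x < p v)].

Lemma mem_back p g v u : (u \in back p g v) = adj g v u && (p u < p v).
Proof. by rewrite mem_sort mem_enum inE. Qed.

Lemma back_uniq p g v : uniq (back p g v).
Proof. by rewrite sort_uniq enum_uniq. Qed.

Lemma size_back p g v : regular_graph g -> size (back p g v) <= d.
Proof.
move=> Hg; rewrite size_sort -cardE -(card_adj v Hg).
by apply/subset_leq_card/subsetP => x; rewrite !inE => /andP[].
Qed.

Lemma mem_early p g v w x : (x \in early p g v w) = adj g w x && (p x < p v).
Proof. by rewrite mem_enum inE. Qed.

Lemma size_early p g v w : regular_graph g -> size (early p g v w) <= d.
Proof.
move=> Hg; rewrite -cardE -(card_adj w Hg).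
by apply/subset_leq_card/subsetP => x; rewrite !inE => /andP[].
Qed.

Lemma back_sorted p g v : sorted (fun x y => p x <= p y) (back p g v).
Proof. by apply: sort_sorted => x y; apply: leq_total. Qed.

Lemma root_lt p g u v : regular_graph g -> root p g u v -> p u < p v.
Proof.
move=> Hg /andP[Huv /forall_inP/(_ v)]; rewrite !inE eqxx orbT => /(_ isT).
rewrite leq_eqVlt => /orP[/eqP/val_inj/perm_inj Euv|//].
by rewrite Euv adjxx in Huv.
Qed.

Lemma nonrootP p g u v : regular_graph g -> adj g u v -> p u < p v ->
  ~~ root p g u v -> exists w, [&& adj g u w, adj g v w & p w < p u].
Proof.
move=> Hg Huv Hlt; rewrite /root Huv /= => /forallPn[y].
rewrite negb_imply -ltnNge !inE => /andP[/or3P[/eqP->|/eqP->|/andP[Hu Hv]] H].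
- by rewrite ltnn in H.
- by have := ltn_trans H Hlt; rewrite ltnn.
- by exists y; rewrite Hu Hv.
Qed.

Definition witness p g u v :=
  odflt u [pick w | [&& adj g u w, adj g v w & p w < p u]].

Lemma witnessP p g u v : regular_graph g -> adj g u v -> p u < p v ->
  ~~ root p g u v ->
  [&& adj g u (witness p g u v), adj g v (witness p g u v)
    & p (witness p g u v) < p u].
Proof.
move=> Hg Huv Hlt Hr; rewrite /witness; case: pickP => [w //|H].
by have [w] := nonrootP Hg Huv Hlt Hr; rewrite H.
Qed.

(* An unused slot, a root given by name, or a back-neighbour given as the [l]-th
   early neighbour of the [j]-th back-neighbour. *)
Definition symbol := (unit + ('I_n + 'I_d * 'I_d))%type.

(** On regular graphs the default of [insubd] is never taken: both lists have at most [d] entries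
    and contain the node looked up. *)
Definition code p g : {ffun 'I_n * 'I_d -> symbol} :=
  [ffun e : 'I_n * 'I_d =>
    let: (v, i) := e in
    let s := back p g v in
    if i < size s then
      let u := nth v s i in
      if root p g u v then inr (inl u) else
      let w := witness p g u v in
      inr (inr (insubd i (index w s), insubd i (index u (early p g v w))))
    else inl tt].

Lemma insubd_inj (i0 : 'I_d) a b : a < d -> b < d ->
  insubd i0 a = insubd i0 b -> a = b.
Proof. by move=> Ha Hb /(congr1 val); rewrite !val_insubd Ha Hb. Qed.

(* Reading the code in increasing order of [p]: once the graph below [v] is
   known, a non-root back-neighbour of [v] is found through an earlier one. *)
Lemma back_code p g g' v : regular_graph g -> regular_graph g' ->
  code p g = code p g' ->
  (forall x y, p x < p v -> p y < p v -> adj g x y = adj g' x y) ->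
  back p g v = back p g' v.
Proof.
move=> Hg Hg' Hc IH.
set s := back p g v; set s' := back p g' v.
have Hs : size s <= d by apply: size_back.
have Hs' : size s' <= d by apply: size_back.
have Hlt (i : 'I_d) : (i < size s) = (i < size s').
  have /ffunP/(_ (v, i)) := Hc; rewrite !ffunE /= -/s -/s'.
  by case: (i < size s); case: (i < size s') => //=; case: (root _ _ _ _).
have Esz : size s = size s'.
  apply/eqP; rewrite eqn_leq; apply/andP; split; rewrite leqNgt; apply/negP=> H.
  - have Hd := leq_trans H Hs.
    by have := Hlt (Ordinal Hd); rewrite /= H ltnn.
  - have Hd := leq_trans H Hs'.
    by have := Hlt (Ordinal Hd); rewrite /= H ltnn.
apply: (@eq_from_nth _ v) => //; elim/ltn_ind => i IHi Hi.
have Hi' : i < size s' by rewrite -Esz.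
have Hd := leq_trans Hi Hs.
have /ffunP/(_ (v, Ordinal Hd)) := Hc; rewrite !ffunE -/s -/s' /= Hi Hi'.
set u := nth v s i; set u' := nth v s' i.
have Hu : u \in s by apply: mem_nth.
have Hu' : u' \in s' by apply: mem_nth.
have := Hu; rewrite mem_back => /andP[Avu Lu].
have := Hu'; rewrite mem_back => /andP[Avu' Lu'].
case: ifP => Hr; case: ifP => Hr' //; first by case.
move/negbT: Hr => Hr; move/negbT: Hr' => Hr'.
rewrite adjC // in Avu; rewrite adjC // in Avu'.
have /and3P[Huw Hvw Hwu] := witnessP Hg Avu Lu Hr.
have /and3P[Huw' Hvw' Hwu'] := witnessP Hg' Avu' Lu' Hr'.
move: (witness p g u v) (witness p g' u' v) Huw Hvw Hwu Huw' Hvw' Hwu'.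
move=> w w' Huw Hvw Hwu Huw' Hvw' Hwu' [E1 E2].
have Hw : w \in s by rewrite mem_back Hvw (ltn_trans Hwu).
have Hw' : w' \in s' by rewrite mem_back Hvw' (ltn_trans Hwu').
have Le_tr : transitive (fun x y => p x <= p y).
  by move=> y x z; apply: leq_trans.
have Le_rf : reflexive (fun x y => p x <= p y) by move=> x; apply: leqnn.
have Hj : index w s = index w' s'.
  by apply: (insubd_inj _ _ E1); [apply: leq_trans Hs | apply: leq_trans Hs'];
    rewrite index_mem.
(* [w] precedes [u] in [p], hence in the sorted list, so the induction on slots applies to it. *)
have Lj : index w s < i.
  rewrite ltnNge; apply/negP => H.
  have := sorted_leq_index Le_tr Le_rf (back_sorted p g v) _ _ Hu Hw.
  by rewrite index_uniq ?back_uniq // => /(_ H); rewrite leqNgt Hwu.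
have Ew : w = w'.
  rewrite -(nth_index v Hw) -(nth_index v Hw') -Hj; apply: IHi => //.
  by apply: ltn_trans Hi.
subst w'.
have Lw := ltn_trans Hwu Lu.
(* Only adjacencies among nodes before [v] matter here, and these agree by [IH]. *)
have Ee : early p g v w = early p g' v w.
  apply: eq_enum => x; rewrite !inE.
  by case Hx: (p x < p v); rewrite ?andbF // IH.
have Hue : u \in early p g v w by rewrite mem_early Lu adjC ?Huw.
have Hue' : u' \in early p g' v w by rewrite mem_early Lu' adjC ?Huw'.
rewrite -(nth_index v Hue) -(nth_index v Hue') -Ee; congr nth.
apply: (insubd_inj (i0 := Ordinal Hd)).
- by apply: leq_trans (size_early p v w Hg); rewrite index_mem.
- apply: leq_trans (size_early p v w Hg); rewrite Ee index_mem //.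
- by rewrite E2 Ee.
Qed.

(** By induction on [k] the graphs agree on the first [k] nodes: an edge is read off the back list
    of its later end. *)
Lemma code_inj p : {in regular_graph &, injective (code p)}.
Proof.
move=> g g' Hg Hg' Hc.
suff H k : forall x y, p x < k -> p y < k -> adj g x y = adj g' x y.
  by apply/ffunP => -[x y]; apply: (H n).
elim: k => // k IH.
have Hb v u : p v < k.+1 -> p u < p v -> adj g v u = adj g' v u.
  move=> Hv Huv.
  have E : back p g v = back p g' v.
    by apply: back_code => // x y Hx Hy; apply: IH; [move: Hx Hv|move: Hy Hv]; lia.
  by have := mem_back p g v u; rewrite E mem_back Huv !andbT.
move=> x y Hx Hy; case: (ltngtP (p x) (p y)) => [L|L|/val_inj/perm_inj->].
- by rewrite adjC // [RHS]adjC //; apply: Hb.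
- exact: Hb.
- by rewrite !adjxx.
Qed.

Local Open Scope ring_scope.

(** Let a symbol naming a root weigh [x] and any other symbol 1. By injectivity the sum is at most
    the total weight of all codes, a product of [n * d] factors [1 + n x + d^2]. *)
Lemma sum_weight_le (K : realFieldType) (p : {perm 'I_n}) (x : K) :
  0 <= x -> n%:R * x <= 1 ->
  \sum_(g | regular_graph g) x ^+ roots p g <= (2 + d * d)%:R ^+ (n * d).
Proof.
move=> x0 xn.
pose wt (a : symbol) : K := if a is inr (inl _) then x else 1.
have wt0 a : 0 <= wt a by case: a => [|[]].
have code_wt g : regular_graph g ->
    x ^+ roots p g = \prod_e wt (code p g e).
  move=> Hg; rewrite /roots -prodrXr.
  rewrite [RHS](eq_bigr (fun e => wt (code p g (e.1, e.2)))) => [|[]//].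
  rewrite -(pair_bigA _ (fun v i => wt (code p g (v, i)))).
  apply: eq_bigr => v _ /=.
  transitivity (\prod_(u <- back p g v) x ^+ root p g u v).
    rewrite [RHS](perm_big _ (permEl (perm_sort _ _))) /= big_enum /=.
    rewrite [RHS]big_mkcond -prodrXr; apply: eq_bigr => u _; rewrite inE.
    case: ifP => // H; case Hr: (root p g u v) => //.
    by move: H; rewrite (root_lt Hg Hr) andbT adjC //; case/andP: Hr => ->.
  rewrite (big_nth v) big_mkord (big_ord_widen d
    (fun i => x ^+ root p g (nth v (back p g v) i) v)) ?size_back //.
  rewrite big_mkcond; apply: eq_bigr => i _; rewrite ffunE /=.
  by case: (i < size _)%N => //; case: (root _ _ _ _).
rewrite (eq_bigr _ code_wt) -(big_imset
    (fun c : {ffun 'I_n * 'I_d -> symbol} => \prod_e wt (c e))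
    (@code_inj p)).
apply: (@le_trans _ _ (\sum_(c : {ffun 'I_n * 'I_d -> symbol}) \prod_e wt (c e))).
  rewrite [leLHS]big_mkcond; apply: ler_sum => c _; case: ifP => // _.
  exact: prodr_ge0.
rewrite -(bigA_distr_bigA (fun (_ : 'I_n * 'I_d) a => wt a)) prodr_const.
rewrite card_prod !card_ord; apply: lerXn2r; rewrite ?nnegrE ?sumr_ge0 //.
rewrite !big_sumType /= !sumr_const card_unit card_prod !card_ord.
by rewrite (natrD _ 2) (natrD _ 1 1) -addrA lerD2l lerD2r; move: xn; rewrite mulr_natl.
Qed.

End Encoding.

(** * Averaging over node orders *)

(** Composing with transpositions shows that all elements of [S] are equally often first, and each
    order has exactly one first element in [S]. *)
Lemma card_argmin n (S : {set 'I_n}) x : x \in S ->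
  #|[set p : {perm 'I_n} | [forall y in S, p x <= p y]]| * #|S| = n`!.
Proof.
move=> Sx; pose A z := [set p : {perm 'I_n} | [forall y in S, p z <= p y]].
have le_A z z' : z \in S -> z' \in S -> #|A z'| <= #|A z|.
  move=> Sz Sz'; rewrite -(card_imset (A z') (mulgI (tperm z z'))).
  apply/subset_leq_card/subsetP => _ /imsetP[p + ->]; rewrite !inE.
  move=> /forall_inP H; apply/forall_inP => y Sy; rewrite !permM tpermL.
  by apply: H; case: tpermP.
have -> : #|A x| * #|S| = \sum_(z in S) #|A z|.
  rewrite mulnC -sum_nat_const; apply: eq_bigr => z Sz.
  by apply/eqP; rewrite eqn_leq !le_A.
rewrite (eq_bigr (fun z => \sum_p (p \in A z : nat))); last first.
  by move=> z _; rewrite -sum1_card big_mkcond.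
rewrite exchange_big /= -card_Sn -sum1_card; apply: eq_bigr => p _.
case: (arg_minnP (fun y => p y : nat) Sx) => z Sz minz.
rewrite (bigD1 z) //= inE big1 ?addn0 => [|y /andP[Sy yz]].
  by have -> : [forall y in S, p z <= p y] by apply/forall_inP.
rewrite inE; apply/eqP; rewrite eqb0; apply/negP => /forall_inP/(_ _ Sz) H.
case/negP: yz; apply/eqP/(@perm_inj _ p)/val_inj/eqP.
by rewrite eqn_leq H; apply: minz.
Qed.

Section Average.

Variable n d : nat.
Implicit Types (g : graph n) (p : {perm 'I_n}) (u v w : 'I_n).

Definition codeg g u v := #|common g u v|.

Lemma card_edge_nbhd g u v : regular_graph d g -> adj g u v ->
  #|edge_nbhd g u v| = (codeg g u v).+2.
Proof.
move=> Hg Huv; rewrite /edge_nbhd !cardsU1 !inE (adjxx _ Hg) (adjxx v Hg) /=.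
by rewrite andbF orbF (adj_neq Hg Huv).
Qed.

Lemma codeg_lt g u v : regular_graph d g -> adj g u v -> codeg g u v < d.
Proof.
move=> Hg Huv; rewrite -(card_adj u Hg) [ltnRHS](cardsD1 v) inE Huv add1n ltnS.
apply/subset_leq_card/subsetP => w; rewrite !inE => /andP[-> Hvw].
by rewrite eq_sym (adj_neq Hg Hvw).
Qed.

Lemma codegC g u v : codeg g u v = codeg g v u.
Proof. by apply: eq_card => w; rewrite !inE andbC. Qed.

Local Open Scope ring_scope.

(** The expectation of [roots p g] over a uniform order [p]. *)
Definition mean_roots (R : realType) g : R :=
  \sum_v \sum_(u | adj g u v) (codeg g u v).+2%:R^-1.

Lemma sum_roots (R : realType) g : regular_graph d g ->
  \sum_p (roots p g)%:R = n`!%:R * mean_roots R g.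
Proof.
move=> Hg; rewrite /roots /mean_roots mulr_sumr.
under eq_bigr do rewrite natr_sum.
rewrite exchange_big; apply: eq_bigr => v _ /=.
under eq_bigr do rewrite natr_sum.
rewrite exchange_big /= mulr_sumr [RHS]big_mkcond; apply: eq_bigr => u _ /=.
rewrite /root; case: ifP => Huv; last by rewrite big1.
have Su : u \in edge_nbhd g u v by rewrite !inE eqxx.
rewrite -(card_argmin Su) (card_edge_nbhd Hg Huv) natrM mulfK ?pnatr_eq0 //.
rewrite -sum1_card natr_sum [RHS]big_mkcond; apply: eq_bigr => p _.
by rewrite inE; case: ifP.
Qed.

(* Jensen, from the tangent line [1 + x <= expR x] at the mean. *)
Lemma expR_mean_le (R : realType) (L : R) g : regular_graph d g ->
  n`!%:R * expR (- (L * mean_roots R g)) <= \sum_p expR (- L) ^+ roots p g.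
Proof.
move=> Hg; set m := mean_roots R g.
apply: (@le_trans _ _ (\sum_p expR (- (L * m)) * (1 + L * (m - (roots p g)%:R)))).
  rewrite -mulr_sumr mulrC ler_wpM2l ?expR_ge0 // big_split /= sumr_const card_Sn.
  rewrite -mulr_sumr sumrB sumr_const card_Sn sum_roots // mulr_natl subrr.
  by rewrite mulr0 addr0.
apply: ler_sum => p _; rewrite -expRM_natl.
have -> : (roots p g)%:R * - L = - (L * m) + L * (m - (roots p g)%:R) by ring.
by rewrite expRD ler_wpM2l ?expR_ge0 // expR_ge1Dx.
Qed.

(** Jensen replaces each term by an average over orders. After exchanging the sums, every single
    order obeys the encoding bound with [x = expR (- L)]. *)
Lemma sum_mean_le (R : realType) (L : R) (A : {set graph n}) :
  n%:R * expR (- L) <= 1 -> {in A, forall g, regular_graph d g} ->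
  \sum_(g in A) expR (- (L * mean_roots R g)) <= (2 + d * d)%:R ^+ (n * d).
Proof.
move=> HL HA; rewrite -(@ler_pM2l _ n`!%:R) ?ltr0n ?fact_gt0 // mulr_sumr.
apply: (@le_trans _ _ (\sum_(g in A) \sum_p expR (- L) ^+ roots p g)).
  by apply: ler_sum => g /HA; apply: expR_mean_le.
rewrite exchange_big /= mulr_natl -card_Sn -sumr_const; apply: ler_sum => p _.
apply: le_trans (sum_weight_le d p (expR_ge0 _) HL).
rewrite big_mkcond [leRHS]big_mkcond; apply: ler_sum => g _.
case: ifP => [/HA -> //|_]; case: ifP => // _.
by rewrite exprn_ge0 ?expR_ge0.
Qed.

End Average.

(** * Triangles and bad nodes *)

Section Triangles.

Variable n d : nat.
Implicit Types (g : graph n) (p : {perm 'I_n}) (u v w : 'I_n).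

(** Double counting of ordered triples of mutually adjacent nodes: each triangle has six
    orderings. *)
Lemma sum_codeg g : regular_graph d g ->
  6 * #|triangles g| <= \sum_v \sum_(u | adj g u v) codeg g u v.
Proof.
move=> Hg.
pose P (e : 'I_n * 'I_n * 'I_n) :=
  [&& adj g e.1.1 e.1.2, adj g e.1.1 e.2 & adj g e.1.2 e.2].
pose tri (e : 'I_n * 'I_n * 'I_n) := e.1.1 |: (e.1.2 |: [set e.2]).
have -> : \sum_v \sum_(u | adj g u v) codeg g u v = \sum_(e | P e) 1.
  rewrite [RHS]big_mkcond.
  rewrite -(pair_bigA _ (fun e w => if P (e, w) then 1 else 0)) /=.
  rewrite -(pair_bigA _ (fun v u => \sum_w if P (v, u, w) then 1 else 0)) /=.
  apply: eq_bigr => v _; rewrite big_mkcond; apply: eq_bigr => u _.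
  rewrite /P /= (adjC _ _ Hg); case: ifP => _; last by rewrite big1.
  rewrite /codeg -sum1_card -big_mkcond; apply: eq_bigl => w.
  by rewrite inE andbC.
have Ptri e : P e -> tri e \in triangles g.
  case: e => [[a b] c] /and3P[/= Hab Hac Hbc]; rewrite inE; apply/andP; split.
    rewrite !cardsU1 !inE cards1 (negbTE (adj_neq Hg Hab)).
    by rewrite (negbTE (adj_neq Hg Hac)) (adj_neq Hg Hbc).
  apply/forall_inP => x Hx; apply/forall_inP => y Hy; apply/implyP.
  move: Hx Hy; rewrite !inE => /or3P[] /eqP-> /or3P[] /eqP->;
    by rewrite ?eqxx // 1?(adjC _ _ Hg).
rewrite (partition_big _ _ Ptri) mulnC -sum_nat_const; apply: leq_sum => t.
rewrite inE => /andP[t3 /forall_inP clq].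
have /card_gt2P[a [b [c [[ta tb tc] [ab bc ca]]]]] : 2 < #|t| by rewrite (eqP t3).
have adj_t x y : x \in t -> y \in t -> x != y -> adj g x y.
  by move=> tx ty xy; have /forall_inP/(_ _ ty)/implyP/(_ xy) := clq x tx.
pose s := [:: (a, b, c); (a, c, b); (b, a, c); (b, c, a); (c, a, b); (c, b, a)].
have -> : 6 = #|s|.
  have ba := ab; have cb := bc; have ac := ca.
  rewrite eq_sym in ba; rewrite eq_sym in cb; rewrite eq_sym in ac.
  apply/esym/card_uniqP; rewrite /= !inE !xpair_eqE.
  by rewrite (negbTE ab) (negbTE bc) (negbTE ca) (negbTE ba) (negbTE cb) (negbTE ac) !andbF.
rewrite sum1_card; apply/subset_leq_card/subsetP => -[[x y] z] Hs.
have H : [&& x \in t, y \in t, z \in t, x != y, x != z & y != z].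
  move: Hs; rewrite !inE !xpair_eqE /=.
  by do 5?[case/orP]; case/andP => /andP[/eqP-> /eqP->] /eqP->;
    rewrite ?ta ?tb ?tc ?ab ?bc ?ca 1?eq_sym ?ab ?bc ?ca // eq_sym ?ab ?bc ?ca // eq_sym.
case/and5P: H => tx ty tz xy /andP[xz yz].
rewrite unfold_in /P /= !adj_t //= eqEcard; apply/andP; split.
  by apply/subsetP => w; rewrite !inE => /or3P[] /eqP->.
by rewrite (eqP t3) !cardsU1 !inE cards1 (negbTE xy) (negbTE xz) yz.
Qed.

(** The [d] other members of the clique are neighbours of [v], which has only [d] of them. *)
Lemma clique_nbr g (S : {set 'I_n}) v : regular_graph d g ->
  S \in cliques g d.+1 -> v \in S -> S :\ v = [set u | adj g v u].
Proof.
move=> Hg; rewrite inE => /andP[/eqP cS /forall_inP clq] Sv.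
apply/eqP; rewrite eqEcard (card_adj _ Hg); apply/andP; split.
  apply/subsetP => u; rewrite !inE => /andP[uv Su].
  by have /forall_inP/(_ _ Su)/implyP := clq v Sv; apply; rewrite eq_sym.
by move: cS; rewrite (cardsD1 v) Sv add1n => -[->].
Qed.

Lemma nonclique_triangles_bad g t v : regular_graph d g ->
  t \in nonclique_triangles d g -> v \in t -> v \in bad_nodes d g.
Proof.
move=> Hg; rewrite !inE => /andP[Ht Hn] tv; apply/andP; split.
  by apply/exists_inP; exists t; rewrite ?inE.
apply: contra Hn => /exists_inP[S HS Sv]; apply/exists_inP; exists S => //.
apply/subsetP => x tx; have [->//|xv] := eqVneq x v.
case/andP: Ht => _ /forall_inP/(_ _ tv)/forall_inP/(_ _ tx)/implyP.
rewrite eq_sym => /(_ xv) Hx.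
have /setP/(_ x) := clique_nbr Hg HS Sv.
by rewrite !inE xv Hx.
Qed.

(** Such a triangle is recovered from one of its nodes [v], which is bad, and the remaining pair,
    one of [2 ^ d] subsets of the neighbourhood of [v]. *)
Lemma card_nonclique_triangles g : regular_graph d g ->
  #|nonclique_triangles d g| <= #|bad_nodes d g| * 2 ^ d.
Proof.
move=> Hg; pose N v := [set u | adj g v u].
pose I := [set e : 'I_n * {set 'I_n} | (e.1 \in bad_nodes d g) && (e.2 \subset N e.1)].
have -> : #|bad_nodes d g| * 2 ^ d = #|I|.
  rewrite -sum_nat_const -sum1_card.
  rewrite (eq_bigr (fun v => \sum_(A : {set 'I_n} | A \subset N v) 1)); last first.
    by move=> v _; rewrite sum1dep_card -(card_adj v Hg) -card_powerset;
      apply: eq_card => A; rewrite !inE.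
  by rewrite pair_big_dep; apply: eq_bigl => -[v A]; rewrite [RHS]inE.
apply: leq_trans (leq_imset_card (fun e => e.1 |: e.2) I).
apply/subset_leq_card/subsetP => t Ht.
have : t \in triangles g by move: Ht; rewrite inE => /andP[].
rewrite inE => /andP[/eqP t3 /forall_inP clq].
have /card_gt0P[v tv] : 0 < #|t| by rewrite t3.
apply/imsetP; exists (v, t :\ v); last by rewrite setD1K.
rewrite inE (nonclique_triangles_bad Hg Ht tv) /=.
apply/subsetP => x; rewrite !inE => /andP[xv tx].
by have /forall_inP/(_ _ tx)/implyP := clq v tv; apply; rewrite eq_sym.
Qed.

Definition mixed g v u := adj g v u && (0 < codeg g v u < d.-1).

Lemma common_full g u v : regular_graph d g -> adj g u v ->
  d.-1 <= codeg g u v -> common g u v = [set w | adj g u w] :\ v.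
Proof.
move=> Hg Huv Hk; apply/eqP; rewrite eqEcard; apply/andP; split.
  apply/subsetP => w; rewrite !inE => /andP[-> Hvw].
  by rewrite eq_sym (adj_neq Hg Hvw).
apply: leq_trans Hk; rewrite -(card_adj u Hg) [X in _ <= X.-1](cardsD1 v).
by rewrite inE Huv.
Qed.

(** Otherwise every edge at [v] has codegree 0 or [d - 1]. A triangle gives an edge [vu] of the
    second kind, so [u] is adjacent to all other neighbours of [v]. Then all edges at [v] are of the
    second kind, and [v] with its neighbours is a clique. *)
Lemma bad_mixed g v : regular_graph d g -> v \in bad_nodes d g ->
  exists u, mixed g v u.
Proof.
move=> Hg; rewrite inE => /andP[/exists_inP[t Ht tv] Hn].
apply/existsP; apply: contraR Hn => /existsPn Hm.
pose N := [set u | adj g v u].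
have dich u : adj g v u -> 0 < codeg g v u -> d.-1 <= codeg g v u.
  by move=> Hu Hk; have := Hm u; rewrite /mixed Hu Hk /= -leqNgt.
have full u w : adj g v u -> 0 < codeg g v u -> adj g v w -> w != u -> adj g u w.
  move=> Hu Hk Hw wu; have /setP/(_ w) := common_full Hg Hu (dich _ Hu Hk).
  by rewrite !inE Hw wu => /andP[].
move: Ht; rewrite inE => /andP[/eqP t3 /forall_inP clq].
have adj_t x y : x \in t -> y \in t -> x != y -> adj g x y.
  by move=> tx ty xy; have /forall_inP/(_ _ ty)/implyP/(_ xy) := clq x tx.
have /card_gt1P[u [w [tu tw uw]]] : 1 < #|t :\ v|.
  by move: t3; rewrite (cardsD1 v) tv add1n => -[->].
move: tu tw; rewrite !inE => /andP[uv tu] /andP[wv tw].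
have Hvu : adj g v u by rewrite adj_t // eq_sym.
have Hvw : adj g v w by rewrite adj_t // eq_sym.
have Hu : 0 < codeg g v u.
  by apply/card_gt0P; exists w; rewrite inE Hvw adj_t.
have pos x : adj g v x -> 0 < codeg g v x.
  move=> Hx; have [->//|xu] := eqVneq x u.
  by apply/card_gt0P; exists u; rewrite inE Hvu (adjC _ _ Hg) full.
apply/exists_inP; exists (v |: N); last by rewrite !inE eqxx.
rewrite inE cardsU1 (card_adj _ Hg) inE (adjxx _ Hg) eqxx /=.
apply/forall_inP => x Hx; apply/forall_inP => y Hy; apply/implyP => xy.
move: Hx Hy xy; rewrite !inE => /orP[/eqP->|Hx] /orP[/eqP->|Hy] xy //.
- by rewrite eqxx in xy.
- by rewrite (adjC _ _ Hg).
- by apply: full => //; [apply: pos | rewrite eq_sym].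
Qed.

Local Open Scope ring_scope.

(* [1/(k+2) = 1/2 - k/(2(d+1)) - k(d-1-k)/(2(d+1)(k+2))]: the line through the
   values at [k = 0] and [k = d - 1] lies strictly above in between. *)
Lemma inv_codeg_le (R : realType) (k : nat) : (k < d)%N ->
  k.+2%:R^-1 <= 2^-1 - k%:R / (2 * d.+1%:R)
                - (0 < k < d.-1)%N%:R / (2 * d.+1%:R ^+ 2) :> R.
Proof.
move=> kd; rewrite -addn2 -(addn1 d) !natrD.
have Hk : k%:R + 1 <= d%:R :> R by rewrite natr1 ler_nat.
have k0 : 0 <= k%:R :> R by [].
set x : R := k%:R in Hk k0 *; set y : R := d%:R in Hk *.
(* For an integer strictly between 0 and [d - 1] this product is at least 1; below, [k + 2 <= d + 1]
   bounds the remaining denominator. *)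
have Hb : (0 < k < d.-1)%N%:R <= x * (y - 1 - x) :> R.
  case: (boolP (0 < k < d.-1)%N) => [/andP[k1 k2]|_] /=; last by nra.
  have : 1 <= x by rewrite ler1n.
  have : x + 2 <= y by rewrite -natrD ler_nat; lia.
  by nra.
set b : R := (_)%:R in Hb *.
have b0 : 0 <= b by [].
rewrite -subr_ge0.
have -> : 2^-1 - x / (2 * (y + 1)) - b / (2 * (y + 1) ^+ 2) - (x + 2)^-1 =
   (x * (y - 1 - x) * (y + 1) - b * (x + 2)) / (2 * (y + 1) ^+ 2 * (x + 2)).
  by field; apply/andP; split; apply: lt0r_neq0; lra.
by apply: divr_ge0; nra.
Qed.

(** Sum [inv_codeg_le] over the [d n] ordered adjacent pairs, with [sum_codeg] for the linear term
    and one mixed edge per bad node. *)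
Lemma mean_roots_le (R : realType) g : regular_graph d g ->
  mean_roots R g <= d%:R * n%:R / 2 - 3 * #|triangles g|%:R / d.+1%:R
                    - #|bad_nodes d g|%:R / (2 * d.+1%:R ^+ 2).
Proof.
move=> Hg; set y : R := d.+1%:R.
have y0 : 0 < y by rewrite ltr0n.
apply: (@le_trans _ _ (\sum_v \sum_(u | adj g u v)
  (2^-1 - (codeg g u v)%:R / (2 * y) - (mixed g v u)%:R / (2 * y ^+ 2)))).
  apply: ler_sum => v _; apply: ler_sum => u Huv.
  apply: le_trans (inv_codeg_le R (codeg_lt Hg Huv)) _.
  by rewrite /mixed (adjC _ _ Hg) Huv codegC.
under eq_bigr => v _ do rewrite !sumrB -!mulr_suml sumr_const.
rewrite !sumrB -!mulr_suml; apply: lerB; first apply: lerB.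
- rewrite (eq_bigr (fun=> d%:R * 2^-1)) => [|v _].
    by rewrite sumr_const card_ord mulrAC mulr_natr.
  rewrite -[in RHS](card_adj v Hg) mulr_natl; congr (_ *+ _).
  by apply: eq_card => u; rewrite !inE (adjC _ _ Hg).
- have -> : 3 * #|triangles g|%:R / y = (6 * #|triangles g|)%:R / (2 * y).
    by rewrite natrM; move: (gt_eqF y0); move: (y) => z Hz; field; rewrite Hz.
  rewrite ler_pM2r ?invr_gt0 ?mulr_gt0 //.
  under eq_bigr do rewrite -natr_sum.
  by rewrite -natr_sum ler_nat sum_codeg.
- rewrite ler_pM2r ?invr_gt0 ?mulr_gt0 ?exprn_gt0 //.
  rewrite -sum1_card natr_sum big_mkcond; apply: ler_sum => v _ /=.
  case: ifP => Hv; last by rewrite sumr_ge0.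
  have [u Hu] := bad_mixed Hg Hv.
  have Huv : adj g u v by rewrite (adjC _ _ Hg); case/andP: Hu.
  by rewrite (bigD1 u) //= Hu lerDl sumr_ge0.
Qed.

End Triangles.

(** * Graphs with many planted cliques *)

Lemma card_lt_pairs d : #|[pred e : 'I_d * 'I_d | e.1 < e.2]| = 'C(d, 2).
Proof.
rewrite -sum1_card big_mkcond /=.
rewrite -(pair_bigA _ (fun i j : 'I_d => if i < j then 1 else 0)) /=.
rewrite exchange_big /= -bin2_sum big_mkord; apply: eq_bigr => j _.
rewrite -big_mkcond /= -(big_ord_widen_cond _ predT (fun=> 1)) //=.
  by rewrite sum1_card card_ord.
exact: ltnW.
Qed.

Lemma triangles_cliques n (g : graph n) k m (C : 'I_k -> {set 'I_n}) :
  (forall x, C x \in cliques g m) -> (forall x y, x != y -> [disjoint C x & C y]) ->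
  k * 'C(m, 3) <= #|triangles g|.
Proof.
move=> HC dC; pose F x := [set t : {set 'I_n} | t \subset C x & #|t| == 3].
have dF x y : x != y -> [disjoint F x & F y].
  move=> xy; apply/pred0P => t /=; rewrite !inE; apply/negP.
  case/andP=> /andP[tx /eqP t3] /andP[ty _].
  have : t \subset C x :&: C y by rewrite subsetI tx.
  by rewrite (disjoint_setI0 (dC _ _ xy)) subset0 -cards_eq0 t3.
have -> : k * 'C(m, 3) = #|\bigcup_x F x|.
  rewrite -sum1_card (partition_disjoint_bigcup _ _ dF).
  rewrite (eq_bigr (fun=> 'C(m, 3))) => [|x _].
    by rewrite sum_nat_const card_ord.
  rewrite sum1_card cards_draws; congr 'C(_, _).
  by have := HC x; rewrite inE => /andP[/eqP].
apply/subset_leq_card/subsetP => t /bigcupP[x _]; rewrite !inE.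
move=> /andP[tC ->] /=; have := HC x; rewrite inE => /andP[_ /forall_inP clq].
apply/forall_inP => a ta; apply/forall_inP => b tb.
by have /forall_inP := clq a (subsetP tC _ ta); apply; apply: (subsetP tC).
Qed.

(* A random lift of the complete graph on [option 'I_d], plus a fixed graph [g0]:
   fibre [i] is glued to fibre [j] by the permutation [trans i j], which the
   gauge [sheet] brings to a permutation [glue] fixing the first [k] points, so
   that each of these spans a clique across all fibres. *)
Section Lift.

Variables (n n0 d q : nat) (g0 : graph n0).
Let V := ('I_q * option 'I_d + 'I_n0)%type.
Variables (f : 'I_n -> V) (h : V -> 'I_n).
Hypotheses (fK : cancel f h) (hK : cancel h f) (Hg0 : regular_graph d g0).

Section Graph.

Variables (tau : {ffun 'I_d -> {perm 'I_q}}).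
Variables (rho : {ffun 'I_d * 'I_d -> {perm 'I_q}}).
Implicit Types i j : option 'I_d.

(** Keeping the identity on fibre [None] fixes the gauge, so that the graph determines [tau]. *)
Definition sheet i : {perm 'I_q} := if i is Some i then tau i else 1%g.

(** [rho] is read only at pairs [i < j]; the inverse in the other direction makes adjacency
    symmetric. *)
Definition glue i j : {perm 'I_q} :=
  match i, j with
  | Some i, Some j =>
    if i < j then rho (i, j) else if j < i then (rho (j, i))^-1%g else 1%g
  | _, _ => 1%g
  end.

Definition trans i j := ((sheet i)^-1 * glue i j * sheet j)%g.

Definition lift_adj (x y : V) :=
  match x, y with
  | inl (a, i), inl (b, j) => (i != j) && (b == trans i j a)
  | inr a, inr b => adj g0 a b
  | _, _ => false
  end.

Definition lift_graph : graph n := [ffun e => lift_adj (f e.1) (f e.2)].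

Lemma glueV i j : glue j i = ((glue i j)^-1)%g.
Proof.
case: i j => [i|] [j|]; rewrite /= ?invg1 //.
by case: (ltngtP i j) => //= _; rewrite ?invgK ?invg1.
Qed.

Lemma transV i j : trans j i = ((trans i j)^-1)%g.
Proof. by rewrite /trans !invMg invgK glueV mulgA. Qed.

Lemma lift_adjC x y : lift_adj x y = lift_adj y x.
Proof.
case: x y => [[a i]|a] [[b j]|b] //=; last exact: adjC Hg0.
rewrite eq_sym; congr andb; rewrite (transV i j).
by apply/eqP/eqP => ->; rewrite ?permK ?permKV.
Qed.

Lemma adj_lift u v : adj lift_graph u v = lift_adj (f u) (f v).
Proof. by rewrite /adj ffunE. Qed.

Lemma card_lift_adj x : #|[set y | lift_adj x y]| = d.
Proof.
case: x => [[a i]|a].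
- transitivity #|[set inl 'I_n0 (trans i j a, j) | j in [set~ i]]|.
    apply: eq_card => y; rewrite inE; apply/idP/imsetP.
      case: y => [[b j]|//] /andP[ij /eqP->]; exists j => //.
      by rewrite !inE eq_sym.
    by case=> j; rewrite !inE => ji ->; rewrite /= eqxx eq_sym ji.
  rewrite card_imset => [|j j' []//].
  by rewrite cardsC1 card_option card_ord.
- transitivity #|[set u | adj g0 a u]|; last exact: card_adj.
  have inr_inj : injective (@inr ('I_q * option 'I_d)%type 'I_n0) by move=> b c [].
  rewrite -[RHS](card_imset _ inr_inj).
  apply: eq_card => y; rewrite inE; apply/idP/imsetP => [|[b]].
    by case: y => [[]//|b] Hb; exists b; rewrite ?inE.
  by rewrite inE => Hb ->.
Qed.

Lemma lift_regular : regular_graph d lift_graph.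
Proof.
apply/andP; split; first (apply/andP; split).
- by apply/forallP => u; apply/forallP => v; rewrite !adj_lift lift_adjC.
- apply/forallP => u; rewrite adj_lift; case: (f u) => [[a i]|a] /=.
    by rewrite eqxx.
  by rewrite (adjxx _ Hg0).
- apply/forallP => v; rewrite -[X in _ == X](card_lift_adj (f v)).
  rewrite -(card_imset _ (can_inj fK)); apply/eqP/eq_card => y.
  rewrite inE; apply/imsetP/idP => [[u]|Hy].
    by rewrite inE adj_lift => Hu ->.
  by exists (h y); rewrite ?inE ?adj_lift hK.
Qed.

Definition lift_clique (a : 'I_q) := [set h (inl (sheet i a, i)) | i : option 'I_d].

Lemma lift_clique_disjoint (a b : 'I_q) : a != b -> [disjoint lift_clique a & lift_clique b].
Proof.
apply: contraR => /pred0Pn[v /andP[/imsetP[i _ ->] /imsetP[j _]]].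
by move/(can_inj hK) => [+ Eij]; rewrite Eij => /perm_inj ->.
Qed.

Variable k : nat.
Hypothesis Hrho : forall i j : 'I_d, i < j -> perm_on [set x : 'I_q | k <= x] (rho (i, j)).

(** [trans i j] sends [sheet i a] to [sheet j (glue i j a)], and [glue i j] fixes [a] because
    [a < k]. *)
Lemma lift_cliqueP (a : 'I_q) : a < k -> lift_clique a \in cliques lift_graph d.+1.
Proof.
move=> ak; rewrite inE; apply/andP; split.
  rewrite card_imset ?card_option ?card_ord // => i j.
  by move/(can_inj hK) => [].
have fix_glue i j : glue i j a = a.
  have Ha : a \notin [set x : 'I_q | k <= x] by rewrite inE -ltnNge.
  case: i j => [i|] [j|] /=; rewrite ?perm1 //.
  case: ltngtP => ij; rewrite ?perm1 //; first by apply: out_perm (Hrho ij) Ha.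
  by apply: (@perm_inj _ (rho (j, i))); rewrite permKV (out_perm (Hrho ij) Ha).
apply/forall_inP => _ /imsetP[i _ ->]; apply/forall_inP => _ /imsetP[j _ ->].
apply/implyP; apply: contraNT; rewrite adj_lift !hK /= => /nandP[/negPn/eqP->//|].
by rewrite /trans !permM permK fix_glue eqxx.
Qed.

Lemma lift_triangles : k <= q -> k * 'C(d.+1, 3) <= #|triangles lift_graph|.
Proof.
move=> kq.
apply: (@triangles_cliques _ _ _ _ (fun x => lift_clique (widen_ord kq x))).
  by move=> x; apply: lift_cliqueP => /=; apply: ltn_ord.
move=> x y xy; apply: lift_clique_disjoint.
by apply: contra xy => /eqP[/val_inj->].
Qed.

End Graph.

(** The graph determines [trans i j] for [i != j]. Those leaving fibre [None] give [tau]; cancelling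
    [tau] in the others gives [rho]. *)
Lemma lift_graph_inj (tau tau' : {ffun 'I_d -> {perm 'I_q}})
    (rho rho' : {ffun 'I_d * 'I_d -> {perm 'I_q}}) :
  (forall e : 'I_d * 'I_d, ~~ (e.1 < e.2) -> rho e = rho' e) ->
  lift_graph tau rho = lift_graph tau' rho' -> tau = tau' /\ rho = rho'.
Proof.
move=> Hr E.
have Eadj x y : lift_adj tau rho x y = lift_adj tau' rho' x y.
  by rewrite -(hK x) -(hK y) -!adj_lift E.
have Et i j : i != j -> trans tau rho i j = trans tau' rho' i j.
  move=> ij; apply/permP => a.
  have := Eadj (inl (a, i)) (inl (trans tau rho i j a, j)).
  by rewrite /= ij eqxx => /esym/eqP.
have Etau : tau = tau'.
  apply/ffunP => i; have := Et None (Some i) isT.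
  by rewrite /trans /= invg1 !mul1g.
split=> //; apply/ffunP => -[i j]; have [ij|] := boolP (i < j); last exact: (Hr (i, j)).
have := Et (Some i) (Some j); rewrite /trans /= ij Etau => H.
apply: (@mulgI _ ((tau' i)^-1)%g); apply: (@mulIg _ (tau' j)); apply: H.
by apply: contraTneq ij => -[->]; rewrite ltnn.
Qed.

End Lift.

Lemma card_many_cliques n n0 d q k (g0 : graph n0) :
  n = n0 + d.+1 * q -> k <= q -> regular_graph d g0 ->
  q`! ^ d * (q - k)`! ^ 'C(d, 2) <=
  #|[set g : graph n | regular_graph d g && (k * 'C(d.+1, 3) <= #|triangles g|)]|.
Proof.
move=> En kq Hg0; pose V := ('I_q * option 'I_d + 'I_n0)%type.
have cV : #|{: V}| = n.
  by rewrite card_sum card_prod card_option !card_ord En addnC mulnC.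
pose f (u : 'I_n) : V := enum_val (cast_ord (esym cV) u).
pose h (x : V) : 'I_n := cast_ord cV (enum_rank x).
have fK : cancel f h by move=> u; rewrite /f /h enum_valK cast_ordKV.
have hK : cancel h f by move=> x; rewrite /f /h cast_ordK enum_rankK.
pose D := [pred e : 'I_d * 'I_d | e.1 < e.2].
(* Entries of [rho] that are never read are set to 1, so that distinct parameters give distinct
   graphs. *)
pose P := pffun_on (1%g : {perm 'I_q}) D (perm_on [set x : 'I_q | k <= x]).
pose I := [set e : {ffun 'I_d -> {perm 'I_q}} * {ffun 'I_d * 'I_d -> {perm 'I_q}}
             | e.2 \in P].
have <- : #|I| = q`! ^ d * (q - k)`! ^ 'C(d, 2).
  transitivity #|setX [set: {ffun 'I_d -> {perm 'I_q}}] [set r | r \in P]|.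
    by apply: eq_card => e; rewrite !inE.
  rewrite cardsX cardsT card_ffun card_Sn card_ord; congr (_ * _).
  rewrite cardsE card_pffun_on card_lt_pairs card_perm; congr (_`! ^ _).
  transitivity #|~: [set x : 'I_q | x < k]|.
    by apply: eq_card => x; rewrite !inE leqNgt.
  rewrite cardsCs setCK card_ord; congr (_ - _).
  rewrite -sum1_card big_mkcond /=.
  under eq_bigr do rewrite inE.
  by rewrite -big_mkcond /= -(big_ord_widen _ (fun=> 1) kq) sum1_card card_ord.
have PD e : e \in I -> forall a : 'I_d * 'I_d, ~~ (a.1 < a.2) -> e.2 a = 1%g.
  rewrite inE => /pfamilyP[/subsetP H _] a Ha; apply/eqP.
  by apply: contraNT Ha => /H.
have PR e : e \in I -> forall i j : 'I_d, i < j ->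
    perm_on [set x : 'I_q | k <= x] (e.2 (i, j)).
  by rewrite inE => /pfamilyP[_ H] i j ij; apply: H.
rewrite -(card_in_imset (f := fun e => lift_graph g0 f e.1 e.2) (D := I)).
  apply/subset_leq_card/subsetP => _ /imsetP[e He ->]; rewrite inE.
  rewrite (lift_regular fK hK Hg0) /=.
  exact: (lift_triangles g0 hK _ (PR e He) kq).
move=> [t r] [t' r'] He He' /= E.
have [|->->//] := lift_graph_inj hK _ E.
by move=> a Ha; rewrite [LHS](PD _ He a Ha) (PD _ He' a Ha).
Qed.

(** * Asymptotics *)

Local Open Scope ring_scope.

Lemma bin_le_exp n m : ('C(n, m) <= 2 ^ n)%N.
Proof.
have [nm|mn] := ltnP n m; first by rewrite bin_small.
have Hm : (m < n.+1)%N by [].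
rewrite -[2%N]/(1 + 1)%N expnDn (bigD1 (Ordinal Hm)) //=.
by rewrite !exp1n !muln1 leq_addr.
Qed.

(** A crude Stirling bound: [q ^ q] is at most the product of the [q] largest factors of the
    factorial of [2q], which is ['C(2q, q)] times the factorial of [q]. *)
Lemma expn_le_fact q : (q ^ q <= 4 ^ q * q`!)%N.
Proof.
apply: (@leq_trans ((q + q) ^_ q)).
  rewrite ffact_prod -[X in (X <= _)%N](_ : \prod_(i < q) q = _)%N.
    by apply: leq_prod => i _; have := ltn_ord i; lia.
  by rewrite prod_nat_const card_ord.
rewrite -bin_ffact leq_mul2r; apply/orP; right.
by apply: leq_trans (bin_le_exp _ _) _; rewrite addnn -mul2n expnM.
Qed.

Lemma lnX (R : realType) (n : nat) (x : R) :
  0 < x -> ln (x ^+ n) = n%:R * ln x.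
Proof. by move=> x0; rewrite lnXn // mulr_natl. Qed.

Lemma ln_fact_ge (R : realType) q :
  q%:R * (ln q%:R - ln 4) <= ln q`!%:R :> R.
Proof.
case: q => [|q]; first by rewrite mul0r fact0 ln1.
have q0 : 0 < q.+1%:R :> R by rewrite ltr0n.
have f0 : 0 < (q.+1)`!%:R :> R by rewrite ltr0n fact_gt0.
have H : (q.+1%:R : R) ^+ q.+1 <= 4 ^+ q.+1 * (q.+1)`!%:R.
  by rewrite -!natrX -natrM ler_nat expn_le_fact.
have := H; rewrite -ler_ln ?posrE ?mulr_gt0 ?exprn_gt0 //.
rewrite lnM ?posrE ?exprn_gt0 // !lnX // mulrBr; lra.
Qed.

(* Supplies the nodes left over by a lift, without constructing regular graphs:
   only the finitely many residue classes of [n] matter. *)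
Lemma bounded_seed d : exists M : nat, forall n (g : graph n), regular_graph d g ->
  exists n0 (g0 : graph n0),
    [/\ (n0 <= M)%N, n0 = n %[mod d.+1] & regular_graph d g0].
Proof.
suff H r : exists M : nat, forall n (g : graph n), regular_graph d g ->
    (n %% d.+1 < r)%N -> exists n0 (g0 : graph n0),
    [/\ (n0 <= M)%N, n0 = n %[mod d.+1] & regular_graph d g0].
  have [M HM] := H d.+1; exists M => n g Hg; apply: (HM n g Hg).
  by rewrite ltn_mod.
elim: r => [|r [M HM]]; first by exists 0%N => n g _; rewrite ltn0.
(* Either some regular graph has residue [r] and becomes the seed, or this residue never occurs. *)
have [[n1 [g1 [Hg1 E1]]]|no] := EM (exists n1 (g1 : graph n1),
    regular_graph d g1 /\ (n1 %% d.+1 = r)%N).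
- exists (maxn M n1) => n g Hg; rewrite ltnS leq_eqVlt => /orP[/eqP E|lt].
    by exists n1, g1; split; rewrite ?leq_maxr // E1 E.
  have [n0 [g0 [le0 E0 H0]]] := HM n g Hg lt.
  by exists n0, g0; split=> //; apply: leq_trans (leq_maxl _ _).
- exists M => n g Hg; rewrite ltnS leq_eqVlt => /orP[/eqP E|]; last exact: (HM n g Hg).
  by case: no; exists n, g.
Qed.

Lemma exists_nat_ge (R : realType) (x : R) :
  exists N : nat, forall n, (N <= n)%N -> x <= n%:R.
Proof.
exists (Num.truncn x).+1 => n Hn; apply: le_trans (ltW (truncnS_gt x)) _.
by rewrite ler_nat.
Qed.

Lemma lnln_ge (R : realType) (Z : R) : exists N : nat, forall n, (N <= n)%N ->
  [/\ 0 < n%:R :> R, expR Z <= ln (n%:R : R) & Z <= ln (ln (n%:R : R))].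
Proof.
have [N HN] := exists_nat_ge (expR (expR Z)); exists N => n /HN Hn.
have n0 : 0 < n%:R :> R by apply: lt_le_trans Hn; apply: expR_gt0.
have H1 : expR Z <= ln (n%:R : R).
  by rewrite -[X in X <= _]expRK ler_ln ?posrE ?expR_gt0.
split=> //.
by rewrite -[X in X <= _]expRK ler_ln ?posrE ?expR_gt0 // (lt_le_trans _ H1) ?expR_gt0.
Qed.

(** A member of the class yields a seed of at most [M] nodes in the residue class of [n]; the other
    nodes carry a lift with [k] about [cn/(d+1)] planted cliques. *)
Lemma ln_Gdc_ge (R : realType) (d : nat) (c : R) : 0 < c < 1 ->
  exists (A : R) (N : nat), forall n, (N <= n)%N -> (0 < #|Gdc d c n|)%N ->
    ln n%:R * (d%:R * n%:R / 2 - 3 * (c * Tmax R d n) / d.+1%:R) - A * n%:R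
    <= ln #|Gdc d c n|%:R.
Proof.
case/andP=> c0 c1; have [M HM] := bounded_seed d.
have y0 : 0 < d.+1%:R :> R by rewrite ltr0n.
have Ey : d.+1%:R = d%:R + 1 :> R by rewrite -natr1.
have b0 : 0 <= ('C(d, 2))%:R :> R by [].
move Ed : (d.+1%:R : R) y0 Ey => y y0 Ey.
move EC : (('C(d, 2))%:R : R) b0 => b b0.
(* Edges of the complete graph on [d + 1] vertices: [d] at a base vertex, ['C(d, 2)] among the
   others. *)
have Eb : d%:R + b = d%:R * y / 2.
  have : (2 * 'C(d, 2) + d = d * d)%N.
    have := mul_bin_diag d 1; rewrite bin1; case: (d) => //= e; lia.
  move/(congr1 (fun k => k%:R : R)); rewrite natrD !natrM EC Ey; lra.
(* [q - k] is about [(1-c) n / (d+1)]; half of it is given up to absorb the seed and the rounding of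
   [k]. *)
pose gam : R := (1 - c) / (2 * y).
have gam0 : 0 < gam by apply: divr_gt0; lra.
pose B : R := ln 4 - ln gam.
have [N HN] := exists_nat_ge (2 * (M%:R + y) / (1 - c) + 1).
(* The first term pays for the factorial estimates. The others are losses from the seed and from
   rounding [k], multiplied by [ln n <= n]. *)
exists (`|B| * (d%:R + b) + d%:R * M%:R / 2 + b), (maxn N M) => n.
rewrite geq_max => /andP[/HN Hn Mn] /card_gt0P[g]; rewrite inE => /and3P[Hs Hr _].
have [n0 [g0 [n0M En Hg0]]] := HM n g (introT andP (conj Hs Hr)).
have n0n : (n0 <= n)%N by apply: leq_trans Mn.
pose q := ((n - n0) %/ d.+1)%N.
have Enq : n = (n0 + d.+1 * q)%N.
  have : (d.+1 %| n - n0)%N by rewrite -eqn_mod_dvd // En.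
  by rewrite /q mulnC => /divnK ->; rewrite subnKC.
(* Rounded up, so that the planted cliques alone supply [c * Tmax] triangles. *)
pose k := (Num.truncn (c * n%:R / y)).+1.
pose x : R := n%:R.
have M0 : 0 <= M%:R :> R by [].
have x1 : 1 <= x by apply: le_trans Hn; rewrite lerDr divr_ge0 //; lra.
have cn0 : 0 <= c * x / y by rewrite divr_ge0 ?mulr_ge0 ?(ltW c0) ?(ltW y0).
have kle : y * k%:R <= c * x + y.
  have /andP[H _] := truncn_itv cn0.
  have : y * k%:R = y * (Num.truncn (c * n%:R / y))%:R + y.
    by rewrite /k -natr1 mulrDr mulr1.
  have : y * (Num.truncn (c * n%:R / y))%:R <= y * (c * x / y) by rewrite ler_pM2l.
  have -> : y * (c * x / y) = c * x by rewrite mulrCA mulfV ?mulr1 // gt_eqF.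
  by lra.
have kge : c * x <= y * k%:R.
  have /andP[_ /ltW H] := truncn_itv cn0.
  have : y * (c * x / y) <= y * k%:R by rewrite ler_pM2l.
  by have -> : y * (c * x / y) = c * x by rewrite mulrCA mulfV ?mulr1 // gt_eqF.
have Ex : x = n0%:R + y * q%:R by rewrite /x {1}Enq natrD natrM Ed.
have n0M' : n0%:R <= M%:R :> R by rewrite ler_nat.
have Hn' : 2 * (M%:R + y) <= (1 - c) * x.
  have : (1 - c) * (2 * (M%:R + y) / (1 - c)) <= (1 - c) * x.
    by rewrite ler_pM2l; [rewrite /x; lra | lra].
  have -> : (1 - c) * (2 * (M%:R + y) / (1 - c)) = 2 * (M%:R + y).
    by rewrite mulrCA mulfV ?mulr1 // gt_eqF //; lra.
  by [].
have Hm : (1 - c) * x / 2 <= y * (q%:R - k%:R).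
  by rewrite mulrBr; lra.
have Hgam : gam * x <= q%:R - k%:R.
  rewrite -(ler_pM2l y0); apply: le_trans Hm.
  by rewrite /gam le_eqVlt; apply/orP; left; apply/eqP; field; rewrite gt_eqF.
have kq : (k <= q)%N.
  rewrite -(ler_nat R) -subr_ge0; apply: le_trans Hgam.
  by rewrite mulr_ge0 //; lra.
have := card_many_cliques Enq kq Hg0.
set F := [set g : graph n | _] => cF.
have FG : (#|F| <= #|Gdc d c n|)%N.
  apply/subset_leq_card/subsetP => h; rewrite !inE.
  case/andP=> /andP[-> ->] /= Ht; move: Ht; rewrite -(ler_nat R).
  apply: le_trans; rewrite /Tmax EC -/x natrM.
  have -> : ('C(d.+1, 3))%:R = y * b / 3 :> R.
    have := mul_bin_diag d.+1 2 => /(congr1 (fun k => k%:R : R)).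
    by rewrite !natrM /= Ed EC; lra.
  have := ler_wpM2r b0 kge; lra.
have pos : 0 < (q`! ^ d * (q - k)`! ^ 'C(d, 2))%:R :> R.
  by rewrite ltr0n muln_gt0 !expn_gt0 !fact_gt0.
have : ln (q`! ^ d * (q - k)`! ^ 'C(d, 2))%:R <= ln #|Gdc d c n|%:R :> R.
  have le_card := leq_trans cF FG.
  by rewrite ler_ln ?posrE ?ler_nat // (lt_le_trans pos) // ler_nat.
apply: le_trans.
rewrite natrM !natrX lnM ?posrE ?exprn_gt0 ?ltr0n ?fact_gt0 //.
rewrite !lnX ?ltr0n ?fact_gt0 // EC.
have L0 : 0 <= ln x by apply: ln_ge0.
have Lx : ln x <= x by apply/ltW/ln_sublinear; lra.
have factB (z : nat) : gam * x <= z%:R -> z%:R * (ln x - B) <= ln z`!%:R.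
  move=> Hz; apply: le_trans (ln_fact_ge R z); rewrite ler_wpM2l //.
  have gx0 : 0 < gam * x by apply: mulr_gt0 => //; lra.
  have : ln (gam * x) <= ln z%:R by rewrite ler_ln ?posrE // (lt_le_trans gx0).
  by rewrite lnM ?posrE //; [rewrite /B; lra | lra].
have Eqk : (q - k)%:R = q%:R - k%:R :> R by rewrite natrB.
have h1 : q%:R * (ln x - B) <= ln q`!%:R.
  by apply: factB; have : 0 <= k%:R :> R by []; lra.
have h2 : (q%:R - k%:R) * (ln x - B) <= ln (q - k)`!%:R.
  by rewrite -Eqk; apply: factB; rewrite Eqk.
have d0 : 0 <= d%:R :> R by [].
apply: le_trans (lerD (ler_wpM2l d0 h1) (ler_wpM2l b0 h2)).
set T := d%:R * q%:R + b * (q%:R - k%:R).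
have -> : d%:R * (q%:R * (ln x - B)) + b * ((q%:R - k%:R) * (ln x - B)) =
          ln x * T - B * T by rewrite /T; ring.
have qx : q%:R <= x by rewrite ler_nat; apply: leq_trans (leq_div _ _) (leq_subr _ _).
have k0 : 0 <= k%:R :> R by [].
have T0 : 0 <= T by rewrite /T addr_ge0 ?mulr_ge0 // subr_ge0 ler_nat.
have Tx : T <= (d%:R + b) * x.
  have := ler_wpM2l d0 qx; have := ler_wpM2l b0 qx; have := mulr_ge0 b0 k0.
  by rewrite /T; lra.
have BT : B * T <= `|B| * (d%:R + b) * x.
  apply: (@le_trans _ _ (`|B| * T)); first by rewrite ler_wpM2r // ler_norm.
  by rewrite -mulrA ler_wpM2l.
have TL : d%:R * x / 2 - 3 * (c * Tmax R d n) / y - (d%:R * M%:R / 2 + b) <= T.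
  have -> : 3 * (c * Tmax R d n) / y = b * (c * x / y).
    by rewrite /Tmax EC -/x; field; rewrite gt_eqF.
  have kle' : k%:R <= c * x / y + 1.
    rewrite -(ler_pM2l y0) mulrDr mulr1.
    by have -> : y * (c * x / y) = c * x by rewrite mulrCA mulfV ?mulr1 // gt_eqF.
  have := ler_wpM2l b0 kle'; have := ler_wpM2l d0 n0M'.
  have : d%:R * x / 2 = d%:R * n0%:R / 2 + (d%:R + b) * q%:R.
    by rewrite Eb Ex; lra.
  by rewrite /T; lra.
have := ler_wpM2l L0 TL.
have K0 : 0 <= d%:R * M%:R / 2 + b by rewrite addr_ge0 // divr_ge0 ?mulr_ge0.
have := ler_wpM2r K0 Lx.
by lra.
Qed.

(** * Rarity of graphs with many bad nodes *)

Definition threshold (R : realType) (n : nat) : R :=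
  ln (ln (n%:R : R)) / ln (n%:R : R) * n%:R.

(** In [sum_mean_le] each graph of [Bad] weighs at least [exp(t - L s)] and the total is
    [exp(O(n))], while the class has at least [exp(L s - A n)] elements. The ratio is
    [exp(O(n) - t)]. *)
Lemma card_bad_le (R : realType) (d : nat) (c eps : R) : 0 < c < 1 -> 0 < eps ->
  exists N : nat, forall n, (N <= n)%N -> (0 < #|Gdc d c n|)%N ->
    #|[set g in Gdc d c n | threshold R n <= #|bad_nodes d g|%:R]|%:R
    <= eps * #|Gdc d c n|%:R.
Proof.
move=> c01 eps0; have [A [N1 HA]] := ln_Gdc_ge d c01.
have y0 : 0 < d.+1%:R :> R by rewrite ltr0n.
move Ed : (d.+1%:R : R) y0 => y y0.
pose K : R := ln (2 + d * d)%:R.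
(* Chosen so that [t] is at least [n] times the sum of the encoding error, the error [A] and
   [|ln eps|]. *)
have [N2 HN2] := lnln_ge (2 * y ^+ 2 * (d%:R * K + A + `|ln eps|)).
exists (maxn N1 N2) => n; rewrite geq_max => /andP[/HA {}HA /HN2[n0 Ln LLn]] Gn0.
have {HA} := HA Gn0; rewrite Ed; set G := Gdc d c n; set Bad := [set g in G | _].
set L := ln n%:R in Ln LLn *.
have L0 : 0 < L by apply: lt_le_trans Ln; apply: expR_gt0.
set s := d%:R * n%:R / 2 - _ / y => HA.
(* [t] is [L] times the saving from [threshold R n] bad nodes; [L] cancels the denominator of the
   threshold. *)
set LL := ln L in LLn; pose t := LL * n%:R / (2 * y ^+ 2).
have Hmean : {in Bad, forall g, L * mean_roots R g <= L * s - t}.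
  move=> g; rewrite !inE => /andP[/and3P[Hs Hr HT] Hb].
  have := mean_roots_le R (introT andP (conj Hs Hr)); rewrite Ed => Hm.
  have -> : L * s - t = L * (s - threshold R n / (2 * y ^+ 2)).
    rewrite /t /threshold -/L -/LL; field.
    by rewrite (gt_eqF y0) (gt_eqF L0).
  rewrite ler_pM2l //; apply: le_trans Hm _; rewrite /s; apply: lerB.
    by apply: lerB => //; rewrite ler_pM2r ?invr_gt0 // ler_pM2l.
  by rewrite ler_pM2r // invr_gt0 mulr_gt0 ?exprn_gt0.
have HL : n%:R * expR (- L) <= 1.
  by rewrite expRN /L lnK ?posrE // mulfV ?gt_eqF.
have Hreg : {in Bad, forall g, regular_graph d g}.
  by move=> g; rewrite !inE => /andP[/and3P[Hs Hr _] _]; apply/andP.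
have K0 : 0 < (2 + d * d)%:R :> R by rewrite ltr0n.
have := sum_mean_le HL Hreg => Hsum.
have {Hsum} Hcard : #|Bad|%:R * expR (- (L * s - t)) <= expR (n%:R * (d%:R * K)).
  have -> : expR (n%:R * (d%:R * K)) = (2 + d * d)%:R ^+ (n * d).
    by rewrite mulrA -natrM expRM_natl /K lnK.
  apply: le_trans Hsum; rewrite mulr_natl -sumr_const; apply: ler_sum => g Hg.
  by rewrite ler_expR lerN2 Hmean.
have HG : expR (L * s - A * n%:R) <= #|G|%:R.
  by rewrite -[leRHS]lnK ?posrE ?ltr0n // ler_expR.
apply: (@le_trans _ _ (expR (n%:R * (d%:R * K) + (L * s - t)))).
  rewrite expRD -ler_pdivrMr ?expR_gt0 //.
  by rewrite -expRN.
apply: (@le_trans _ _ (eps * expR (L * s - A * n%:R))); last first.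
  by rewrite ler_pM2l.
rewrite -[eps]lnK ?posrE // -expRD ler_expR.
have n1 : 1 <= n%:R :> R.
  by rewrite ler1n lt0n; apply: contraTneq n0 => ->; rewrite ltxx.
have Ht : (d%:R * K + A + `|ln eps|) * n%:R <= t.
  rewrite /t mulrAC ler_pM2r ?ltr0n -?(ltr0n R) ?n0 //.
  by rewrite ler_pdivlMr ?mulr_gt0 ?exprn_gt0 // mulrC.
have : - ln eps <= `|ln eps| by rewrite -normrN ler_norm.
have : `|ln eps| <= `|ln eps| * n%:R by rewrite ler_peMr.
by move: Ht; rewrite !mulrDl; lra.
Qed.

(** With [x = ln (ln n)], [ln n = exp(x/2)^2 >= (x/2)^2], which is at least [x / delta] once
    [x >= 4 / delta]. *)
Lemma threshold_le (R : realType) (delta : R) : 0 < delta ->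
  exists N : nat, forall n, (N <= n)%N -> threshold R n <= delta * n%:R.
Proof.
move=> delta0; have [N HN] := lnln_ge (4 / delta).
exists N => n /HN[n0 Ln LLn]; rewrite /threshold ler_pM2r //.
have L0 : 0 < ln n%:R :> R by apply: lt_le_trans Ln; apply: expR_gt0.
rewrite ler_pdivrMr //; move: LLn; set x := ln (ln _) => Hx.
have -> : ln n%:R = expR (x / 2) ^+ 2 :> R.
  by rewrite -expRM_natl mulrCA mulfV ?mulr1 ?pnatr_eq0 // lnK.
have x0 : 0 < x by apply: lt_le_trans Hx; apply: divr_gt0.
have Hdx : 4 <= delta * x by rewrite mulrC -ler_pdivrMr.
have x2 : 0 <= x / 2 by lra.
have : (x / 2) ^+ 2 <= expR (x / 2) ^+ 2.
  rewrite lerXn2r ?nnegrE ?expR_ge0 //.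
  by apply: le_trans (expR_ge1Dx _); rewrite lerDr.
move/(ler_wpM2l (ltW delta0)); apply: le_trans.
have := ler_wpM2r (ltW x0) Hdx; rewrite expr2; lra.
Qed.

Lemma probG_ge (R : realType) (d n : nat) (c eps : R) (P Q : pred (graph n)) :
  (0 < #|Gdc d c n|)%N ->
  #|[set g in Gdc d c n | ~~ Q g]|%:R <= eps * #|Gdc d c n|%:R ->
  {in Gdc d c n, forall g, Q g -> P g} ->
  1 - eps <= probG d c P.
Proof.
move=> G0 HQ QP; rewrite /probG ler_pdivlMr ?ltr0n // mulrBl mul1r.
move: (Gdc d c n) G0 HQ QP => G G0 HQ QP.
have : (#|G| <= #|[set g in G | P g]| + #|[set g in G | ~~ Q g]|)%N.
  apply: leq_trans (leq_card_setU _ _); apply/subset_leq_card/subsetP => g Hg.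
  by rewrite inE !inE Hg /=; case: (boolP (Q g)) => [/(QP _ Hg)->|]; rewrite ?orbT.
by rewrite -(ler_nat R) natrD; lra.
Qed.

Theorem theorem2 (R : realType) (d : nat) (c : R) :
  0 < c < 1 ->
  (* w.h.p. fewer than (log log n / log n) n bad nodes *)
  (forall eps : R, 0 < eps -> exists N : nat, forall n : nat, (N <= n)%N ->
     (0 < #|Gdc d c n|)%N ->
     1 - eps <= probG d c (fun g : graph n =>
        (#|bad_nodes d g|)%:R < ln (ln (n%:R : R)) / ln (n%:R : R) * (n%:R : R)))
  /\
  (* consequently w.h.p. the number of triangles not in a (d+1)-clique is o(n) *)
  (forall delta eps : R, 0 < delta -> 0 < eps -> exists N : nat,
     forall n : nat, (N <= n)%N -> (0 < #|Gdc d c n|)%N ->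
     1 - eps <= probG d c (fun g : graph n =>
        (#|nonclique_triangles d g|)%:R < delta * (n%:R : R))).
Proof.
move=> c01.
pose Q n (g : graph n) := #|bad_nodes d g|%:R < threshold R n.
have few_bad (eps : R) n : #|[set g in Gdc d c n | threshold R n <= #|bad_nodes d g|%:R]|%:R
    <= eps * #|Gdc d c n|%:R ->
    #|[set g in Gdc d c n | ~~ Q n g]|%:R <= eps * #|Gdc d c n|%:R.
  by apply: le_trans; rewrite ler_nat; apply/subset_leq_card/subsetP => g;
    rewrite !inE -leNgt.
split=> [eps eps0|delta eps delta0 eps0]; have [N HN] := card_bad_le d c01 eps0.
  by exists N => n Nn G0; apply: (probG_ge G0 (few_bad _ _ (HN n Nn G0))).
(* Dividing by [2 ^ d] offsets the factor in [card_nonclique_triangles]. *)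
have [M HM] := threshold_le (divr_gt0 delta0 (exprn_gt0 d (ltr0n R 2))).
exists (maxn N M) => n; rewrite geq_max => /andP[Nn /HM Mn] G0.
apply: (probG_ge G0 (few_bad _ _ (HN n Nn G0))) => g; rewrite inE.
case/and3P=> Hs Hr _ Hb.
have := card_nonclique_triangles (introT andP (conj Hs Hr)).
rewrite -(ler_nat R) natrM natrX => /le_lt_trans; apply.
by rewrite -ltr_pdivlMr ?exprn_gt0 // mulrAC (lt_le_trans Hb).
Qed.
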